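(* For any $\tau$ and any $R$-round approximate histogram protocol in the linear aggregation model with per-user communication cost $o\big(\min\{\frac{mn\sqrt{R}}{\tau},\,mn\}\big)$ bits, there exists a dataset $\{h_i\}_{i\in B_r,\,r\in[R]}$ (with each $\|h_i\|_1\le m$) such that the protocol cannot solve the $\tau$-approximate histogram problem with error probability at most $1/5$.
   Context: Setting (multi-round linear aggregation model). There are $R$ rounds; in round $r\in[R]$ a set $B_r$ of $n$ users participates, and the sets $B_1,\dots,B_R$ are pairwise disjoint. Each user $i$ holds a local histogram $h_i:\mathcal{X}\to\mathbb{Z}_{\ge0}$ over a finite domain $\mathcal{X}$ of size $d$, with $\|h_i\|_1\le m$. Let $h^{(r)}=\sum_{i\in B_r}h_i$ and $h^{[R]}=\sum_{r\in[R]}h^{(r)}$. A (possibly interactive) linear sketching protocol with per-user communication cost $\ell$ bits: with shared randomness $U$, in round $r$ each user $i\in B_r$ sends $Y_i=f_i(h_i,U)$ in a finite ring $G_r$ whose elements are described by $\ell$ bits (the map $f_i$ may depend on previously observed sums $Y^{(1)},\dots,Y^{(r-1)}$), and the server observes only the ring sum $Y^{(r)}=\sum_{i\in B_r}Y_i$; the server's output depends only on $(Y^{(1)},\dots,Y^{(R)},U)$. The $\tau$-approximate histogram problem: output $\widehat{h}^{[R]}:\mathcal{X}\to\mathbb{R}$ with $|\widehat{h}^{[R]}(x)-h^{[R]}(x)|\le\tau$ for all $x\in\mathcal{X}$; the protocol errs if this fails.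
   Formalization: Added: τ > 0; 2τ < mnR (otherwise the constant answer mnR/2 succeeds with zero bits); and domain size d ≥ min{mn√R/τ, mn} (for d = 1 and τ ≤ √R, exact counts cost only about log(mn) = o(mn) bits). *)

(* Defs.v *)
From HB Require Import structures.
From mathcomp Require Import all_boot all_order all_algebra.
From mathcomp Require Import all_classical all_reals all_analysis.

Set Implicit Arguments.
Unset Strict Implicit.
Unset Printing Implicit Defensive.

Import Order.TTheory GRing.Theory Num.Theory.
Import numFieldNormedType.Exports.

Local Open Scope classical_set_scope.
Local Open Scope ring_scope.

Definition histogram (X : finType) := {ffun X -> nat}.

Definition l1norm (X : finType) (h : histogram X) : nat := (\sum_x h x)%N.

Definition dataset (I X : finType) := I -> histogram X.

(* The shared randomness U is the sample point u of an arbitrary probability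
   space; there is no other source of randomness. Rings may be trivial
   (finPzRingType), so that zero-bit messages are allowed. The argument of
   type {dffun forall s, ring s} of [enc r] holds the sums of the rounds s < r
   and is zero from round r on. *)
Record protocol (R : realType) (rounds : nat) (I X : finType) := Protocol {
  display : measure_display;
  sample : measurableType display;
  shared : probability sample R;
  ring : 'I_rounds -> finPzRingType;
  enc : forall r : 'I_rounds, I ->
    {dffun forall s, ring s} -> histogram X -> sample -> ring r;
  out : {dffun forall s, ring s} -> sample -> X -> R;
  enc_measurable : forall r i y h (g : ring r),
    measurable [set u : sample | enc r i y h u = g];
  out_measurable : forall y x,
    measurable_fun [set: sample] (fun u => out y u x)
}.

(* Equivalently, every ring injects into the bit strings of length ell. *)
Definition has_cost (R : realType) (rounds : nat) (I X : finType)
    (pi : protocol R rounds I X) (ell : nat) : Prop :=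
  forall r, (#|ring pi r| <= 2 ^ ell)%N.

Section Execution.
Variables (R : realType) (rounds : nat) (I X : finType).
Variables (B : 'I_rounds -> {set I}) (pi : protocol R rounds I X).
Variables (h : dataset I X) (u : sample pi).

(* The sums observed in the first k rounds, padded with zeros. *)
Fixpoint observed (k : nat) : {dffun forall s, ring pi s} :=
  if k is k'.+1 then
    let y := observed k' in
    [ffun s : 'I_rounds => if s == k' :> nat then \sum_(i in B s) enc s i y (h i) u
               else y s]
  else [ffun s : 'I_rounds => 0].

Definition estimate (x : X) : R := out (observed rounds) u x.

End Execution.

Definition total_histogram (rounds : nat) (I X : finType)
    (B : 'I_rounds -> {set I}) (h : dataset I X) (x : X) : nat :=
  (\sum_(r < rounds) \sum_(i in B r) h i x)%N.

Definition error_event (R : realType) (rounds : nat) (I X : finType)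
    (B : 'I_rounds -> {set I}) (pi : protocol R rounds I X)
    (h : dataset I X) (tau : R) : set (sample pi) :=
  [set u | ~ forall x, `|estimate B h u x - (total_histogram B h x)%:R| <= tau].

Definition error_prob (R : realType) (rounds : nat) (I X : finType)
    (B : 'I_rounds -> {set I}) (pi : protocol R rounds I X)
    (h : dataset I X) (tau : R) : \bar R :=
  shared pi (error_event B h tau).

Definition cost_bound (R : realType) (m n rounds : nat) (tau : R) : R :=
  Num.min ((m * n)%:R * Num.sqrt rounds%:R / tau) (m * n)%:R.

(* Main.v *)
(** Fix the shared randomness [u]. In each round the summed histogram is
    [a * w] for a uniform [w] in the cube [{0,1}^D], where [D] is
    [cost_bound / 32] and [a = m n / D], so that [tau] is at most a sixteenth
    of [a * sqrt rounds]. Given the transcript, the [w]'s of the rounds are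
    independent and each is uniform on a set of inputs. As a message has only
    [ell << D] bits, these sets are so large on average that, by the level-1
    inequality, some coordinate is almost unbiased in almost every round. Its
    sum over the rounds then has standard deviation of order
    [a * sqrt rounds], and a second-moment argument (with fourth moments) shows
    that it is not within [tau] of any value that depends on the transcript
    only, with probability at least [1/4]. Averaging over the cube yields one
    bad dataset. If [ell = 0] the transcript is constant, and two datasets
    suffice. *)

Require Import Defs.
From HB Require Import structures.
From mathcomp Require Import all_boot all_order all_algebra.
From mathcomp Require Import all_classical all_reals all_analysis.
From mathcomp Require Import measurable_realfun.
From mathcomp Require Import ring lra zify.

Set Implicit Arguments.
Unset Strict Implicit.
Unset Printing Implicit Defensive.

Import Order.TTheory GRing.Theory Num.Theory.
Import numFieldNormedType.Exports.

Local Open Scope classical_set_scope.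
Local Open Scope ring_scope.

(** * Level-1 inequality on the cube *)

Definition pm {R : realType} (b : bool) : R := if b then 1 else -1.

(** Multiply by [1 - y]: as [1 - y <= expR (- y)], the left side becomes at most 1, while the right
    side becomes [1 + y ^ 2 (1 - 2 y)]. *)
Lemma expR_le_quad (R : realType) (y : R) :
  y <= 1 / 2 -> expR y <= 1 + y + 2 * y ^+ 2.
Proof.
move=> hy; have y1 : 0 < 1 - y by lra.
rewrite -(ler_pM2r y1); apply: (@le_trans _ _ (expR y * expR (- y))).
  by rewrite ler_pM2l ?expR_gt0//; exact: expR_ge1Dx.
rewrite expRxMexpNx_1.
have -> : (1 + y + 2 * y ^+ 2) * (1 - y) = 1 + y ^+ 2 * (1 - 2 * y) by ring.
by rewrite lerDl mulr_ge0 ?sqr_ge0//; lra.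
Qed.

(** A cosh bound with a non-optimal exponent: the linear terms of the quadratic bounds at [y] and
    [- y] cancel. *)
Lemma expR_add_expRN_le (R : realType) (y : R) : `|y| <= 1 / 2 ->
  expR y + expR (- y) <= 2 * expR (2 * y ^+ 2).
Proof.
rewrite ler_norml => /andP[h1 h2].
have := expR_le_quad h2; have := @expR_le_quad R (- y) ltac:(lra).
by have := expR_ge1Dx (2 * y ^+ 2); rewrite sqrrN; lra.
Qed.

(* Jensen bounds the exponential moment of [\sum_j v j * pm (w j)] over [S]
   from below by [expR] of its mean; over the whole cube it factorizes. *)
Lemma level1_inequality (R : realType) (J : finType)
    (S : {set {ffun J -> bool}}) (v : J -> R) :
  (forall j, \sum_(w in S) pm (w j) = #|S|%:R * v j) ->
  #|S|%:R * expR ((\sum_j v j ^+ 2) / 8) <= #|{ffun J -> bool}|%:R.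
Proof.
move=> hv; have [S0|S0] := posnP #|S|; first by rewrite S0 mul0r.
have v1 j : `|v j| <= 1.
  have Sp : 0 < #|S|%:R :> R by rewrite ltr0n.
  rewrite -(ler_pM2l Sp) -[X in X * _ <= _](gtr0_norm Sp) -normrM -hv mulr1.
  apply: le_trans (ler_norm_sum _ _ _) _.
  rewrite -sum1_card natr_sum ler_sum// => w _.
  by rewrite /pm; case: ifP; rewrite ?normrN normr1.
set q := _ / 8.
(* The tilt [t = v / 4] maximizes [v t - 2 t ^ 2]: the mean of [L] over [S] is [2 q], while the
   exponential moment over the cube costs only [q] in the exponent. *)
pose L (w : {ffun J -> bool}) := \sum_j pm (w j) * (v j / 4).
have low : #|S|%:R * expR (2 * q) <= \sum_(w in S) expR (L w).
  have mean : \sum_(w in S) L w = #|S|%:R * (2 * q).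
    rewrite /L exchange_big/= /q mulrA !mulr_suml !mulr_sumr.
    apply: eq_bigr => j _; rewrite -mulr_suml hv; by field.
  (* Jensen through the tangent of the exponential at the mean [2 q]; the linear correction sums to
     zero. *)
  have -> : #|S|%:R * expR (2 * q) =
      \sum_(w in S) expR (2 * q) * (1 + (L w - 2 * q)).
    rewrite -mulr_sumr big_split/= sumrB mean !sumr_const.
    by rewrite -[2 * q *+ _]mulr_natl; ring.
  apply: ler_sum => w _.
  rewrite -[in leRHS](subrKC (2 * q) (L w)) expRD ler_pM2l ?expR_gt0//.
  exact: expR_ge1Dx.
have up : \sum_(w in S) expR (L w) <= #|{ffun J -> bool}|%:R * expR q.
  apply: (@le_trans _ _ (\sum_w expR (L w))).
    rewrite [leRHS](bigID (mem S))/= lerDl sumr_ge0//.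
  under eq_bigr do rewrite /L expR_sum.
  rewrite -(bigA_distr_bigA (fun j b => expR (pm b * (v j / 4)))).
  rewrite card_ffun card_bool natrX -prodr_const /q mulr_suml expR_sum.
  rewrite -big_split/=; apply: ler_prod => j _; rewrite big_bool/= /pm.
  rewrite addr_ge0 ?expR_ge0//= mul1r mulN1r.
  have -> : v j ^+ 2 / 8 = 2 * (v j / 4) ^+ 2 by field.
  apply: expR_add_expRN_le.
  by rewrite normrM (@ger0_norm _ 4^-1)//; have := v1 j; lra.
have := le_trans low up.
have -> : 2 * q = q + q by ring.
by rewrite expRD mulrA ler_pM2r ?expR_gt0.
Qed.

(** * Moments of sums of independent variables *)

Section SumMoments.
Variables (R : realType) (A : finType).

Definition consf n (w : A) (f : {ffun 'I_n -> A}) : {ffun 'I_n.+1 -> A} :=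
  [ffun i => if unlift ord0 i is Some j then f j else w].

Lemma sum_consf n (G : {ffun 'I_n.+1 -> A} -> R) :
  \sum_f G f = \sum_w \sum_f G (consf w f).
Proof.
rewrite pair_big/= (reindex (fun p : A * {ffun 'I_n -> A} => consf p.1 p.2))//=.
exists (fun f => (f ord0, [ffun j => f (lift ord0 j)])) => [[w f] _|f _] /=.
  congr (_, _); first by rewrite ffunE unlift_none.
  by apply/ffunP => j; rewrite !ffunE liftK.
by apply/ffunP => i; rewrite ffunE; case: unliftP => [j ->|->]; rewrite ?ffunE.
Qed.

Definition mean n (p : 'I_n -> A -> R) (F : {ffun 'I_n -> A} -> R) : R :=
  \sum_(f : {ffun 'I_n -> A}) (\prod_i p i (f i)) * F f.

Lemma meanS n (p Z : 'I_n.+1 -> A -> R) (phi : R -> R) :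
  mean p (fun f : {ffun 'I_n.+1 -> A} => phi (\sum_i Z i (f i))) =
  \sum_w p ord0 w * mean (fun i => p (lift ord0 i))
    (fun f : {ffun 'I_n -> A} => phi (Z ord0 w + \sum_i Z (lift ord0 i) (f i))).
Proof.
rewrite /mean sum_consf; apply: eq_bigr => w _; rewrite mulr_sumr.
apply: eq_bigr => f _; rewrite !big_ord_recl/= mulrA ffunE unlift_none.
congr (_ * _ * phi (_ + _)); apply: eq_bigr => i _; by rewrite ffunE liftK.
Qed.

(** Condition on the first coordinate and expand [(x + z) ^ k]; this calls on all lower moments of
    the tail, hence the joint induction. The terms [c i - 3 * a i ^ 2] are fourth cumulants, which
    add up over independent summands. *)
Lemma sum_moments n (p Z : 'I_n -> A -> R) (a b c : 'I_n -> R) :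
  (forall i, \sum_w p i w = 1) ->
  (forall i, \sum_w p i w * Z i w = 0) ->
  (forall i, \sum_w p i w * Z i w ^+ 2 = a i) ->
  (forall i, \sum_w p i w * Z i w ^+ 3 = b i) ->
  (forall i, \sum_w p i w * Z i w ^+ 4 = c i) ->
  let moment k := mean p (fun f : {ffun 'I_n -> A} => (\sum_i Z i (f i)) ^+ k) in
  [/\ moment 0%N = 1, moment 1%N = 0, moment 2%N = \sum_i a i,
      moment 3%N = \sum_i b i &
      moment 4%N = 3 * (\sum_i a i) ^+ 2 + \sum_i (c i - 3 * a i ^+ 2)].
Proof.
elim: n p Z a b c => [|n IH] p Z a b c h0 h1 h2 h3 h4 moment.
  rewrite /moment /mean.
  have E (F : {ffun 'I_0 -> A} -> R) :
      (\sum_(f : {ffun 'I_0 -> A}) (\prod_(i < 0) p i (f i)) * F f) = F (ffun0 (card_ord 0)).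
    rewrite (big_pred1 (ffun0 (card_ord 0))) => [|f]; first by rewrite big_ord0 mul1r.
    by symmetry; apply/eqP/ffunP => -[].
  by rewrite !E !big_ord0; split; ring.
have := IH (fun i => p (lift ord0 i)) (fun i => Z (lift ord0 i))
  (fun i => a (lift ord0 i)) (fun i => b (lift ord0 i)) (fun i => c (lift ord0 i))
  (fun i => h0 _) (fun i => h1 _) (fun i => h2 _) (fun i => h3 _)
  (fun i => h4 _).
rewrite /= => -[]; set M := mean _.
move=> m0 m1 m2 m3 m4.
(* Linearity on quartics in the tail sum, evaluated by the induction hypothesis. *)
have ML k1 k2 k3 k4 k5 :
    M (fun f : {ffun 'I_n -> A} => let z := \sum_(i < n) Z (lift ord0 i) (f i) in
      k1 * z ^+ 0 + k2 * z ^+ 1 + k3 * z ^+ 2 + k4 * z ^+ 3 + k5 * z ^+ 4) =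
    k1 * 1 + k2 * 0 + k3 * \sum_i a (lift ord0 i) +
    k4 * \sum_i b (lift ord0 i) + k5 *
      (3 * (\sum_i a (lift ord0 i)) ^+ 2 +
       \sum_i (c (lift ord0 i) - 3 * a (lift ord0 i) ^+ 2)).
  rewrite -m4 -m3 -m2.
  transitivity (let P k := M (fun f : {ffun 'I_n -> A} =>
      (\sum_(i < n) Z (lift ord0 i) (f i)) ^+ k) in
    k1 * P 0%N + k2 * P 1%N + k3 * P 2%N + k4 * P 3%N + k5 * P 4%N);
    last by rewrite /= m0 m1.
  rewrite /M /mean !mulr_sumr -!big_split/=.
  by apply: eq_bigr => f _ /=; ring.
have step k (k1 k2 k3 k4 k5 : R -> R) :
    (forall x z : R, (x + z) ^+ k =
      k1 x * z ^+ 0 + k2 x * z ^+ 1 + k3 x * z ^+ 2 + k4 x * z ^+ 3 + k5 x * z ^+ 4) ->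
    moment k = \sum_w p ord0 w * (let x := Z ord0 w in k1 x * 1 + k2 x * 0 +
      k3 x * \sum_i a (lift ord0 i) + k4 x * \sum_i b (lift ord0 i) + k5 x *
      (3 * (\sum_i a (lift ord0 i)) ^+ 2 +
       \sum_i (c (lift ord0 i) - 3 * a (lift ord0 i) ^+ 2))).
  move=> H; rewrite /moment (meanS p Z (fun x => x ^+ k)).
  apply: eq_bigr => w _; congr (_ * _); rewrite /= -ML -/M; congr (M _).
  by apply/funext => f; rewrite /= H.
rewrite !big_ord_recl.
have e := (h0 ord0, h1 ord0, h2 ord0, h3 ord0, h4 ord0).
move: (\sum_(i < n) a _) (\sum_(i < n) b _) (\sum_(i < n) (c _ - _)) step
  => sa sb sc step.
(* Averages a quartic in the first variable. The coefficient [k2] vanishes with the first moment, so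
   it is supplied explicitly below. *)
have fin (k1 k2 k3 k4 k5 : R) : \sum_w p ord0 w *
    (k1 + k2 * Z ord0 w + k3 * Z ord0 w ^+ 2 + k4 * Z ord0 w ^+ 3 + k5 * Z ord0 w ^+ 4)
    = k1 + k3 * a ord0 + k4 * b ord0 + k5 * c ord0.
  rewrite -(h4 ord0) -(h3 ord0) -(h2 ord0).
  transitivity (k1 * (\sum_w p ord0 w) + k2 * (\sum_w p ord0 w * Z ord0 w) +
    k3 * (\sum_w p ord0 w * Z ord0 w ^+ 2) + k4 * (\sum_w p ord0 w * Z ord0 w ^+ 3)
    + k5 * (\sum_w p ord0 w * Z ord0 w ^+ 4)); last by rewrite h0 h1; ring.
  rewrite !mulr_sumr -!big_split/=.
  by apply: eq_bigr => w _; ring.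
split.
- rewrite (step 0%N (fun=> 1) (fun=> 0) (fun=> 0) (fun=> 0) (fun=> 0)); last first.
    by move=> *; ring.
  rewrite -[RHS]addr0; under eq_bigr do rewrite !mul0r !addr0 mulr1 mulr1.
  by rewrite h0 addr0.
- rewrite (step 1%N id (fun=> 1) (fun=> 0) (fun=> 0) (fun=> 0)); last first.
    by move=> *; ring.
  transitivity (\sum_w p ord0 w * Z ord0 w); last exact: h1.
  by apply: eq_bigr => w _ /=; ring.
- rewrite (step 2%N (fun x => x ^+ 2) (fun x => 2 * x) (fun=> 1) (fun=> 0)
    (fun=> 0)); last by move=> *; ring.
  rewrite [RHS](_ : _ = sa + 1 * a ord0 + 0 * b ord0 + 0 * c ord0); last by ring.
  by rewrite -(fin _ 0); apply: eq_bigr => w _ /=; ring.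
- rewrite (step 3%N (fun x => x ^+ 3) (fun x => 3 * x ^+ 2) (fun x => 3 * x)
    (fun=> 1) (fun=> 0)); last by move=> *; ring.
  rewrite [RHS](_ : _ = sb + 0 * a ord0 + 1 * b ord0 + 0 * c ord0); last by ring.
  by rewrite -(fin _ (3 * sa)); apply: eq_bigr => w _ /=; ring.
- rewrite (step 4%N (fun x => x ^+ 4) (fun x => 4 * x ^+ 3) (fun x => 6 * x ^+ 2)
    (fun x => 4 * x) (fun=> 1)); last by move=> *; ring.
  rewrite [RHS](_ : _ = (3 * sa ^+ 2 + sc) + (6 * sa) * a ord0 + 0 * b ord0
    + 1 * c ord0); last by ring.
  by rewrite -(fin _ (4 * sb)); apply: eq_bigr => w _ /=; ring.
Qed.

End SumMoments.

(** * Product sets of inputs *)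

Lemma prod_indic (R : realType) (A : finType) n (S : 'I_n -> {set A})
    (f : {ffun 'I_n -> A}) :
  \prod_i (f i \in S i)%:R = [forall i, f i \in S i]%:R :> R.
Proof.
case: forallP => [h|/existsNP[i /negP/negbTE hi]].
  by rewrite big1// => i _; rewrite h.
by rewrite (bigD1 i)//= hi mul0r.
Qed.

Definition box (A : finType) n (S : 'I_n -> {set A}) : {set {ffun 'I_n -> A}} :=
  [set f : {ffun _} | [forall i, f i \in S i]]%SET.

Lemma card_box (R : realType) (A : finType) n (S : 'I_n -> {set A}) :
  #|box S|%:R =
  \prod_i #|S i|%:R :> R.
Proof.
rewrite -sum1_card natr_sum big_mkcond/=.
transitivity (\sum_(f : {ffun 'I_n -> A}) \prod_i (f i \in S i)%:R : R).
  by apply: eq_bigr => f _; rewrite prod_indic inE; case: ifP.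
rewrite -(bigA_distr_bigA (fun i w => (w \in S i)%:R)).
apply: eq_bigr => i _; rewrite -sum1_card natr_sum [RHS]big_mkcond.
by apply: eq_bigr => w _; case: ifP.
Qed.

(** * Anticoncentration of sums of nearly unbiased signs *)

Section Anticoncentration.
Variables (R : realType) (A : finType) (chi : A -> bool).

(** As a sign squares to 1, every polynomial in it is affine, so all moments are functions of the
    bias [v]. *)
Lemma pm_moments (S : {set A}) (v : R) : (0 < #|S|)%N ->
  \sum_(w in S) pm (chi w) = #|S|%:R * v ->
  let p w := (w \in S)%:R / #|S|%:R in
  let moment k := \sum_w p w * (pm (chi w) - v) ^+ k in
  [/\ \sum_w p w = 1, \sum_w p w * (pm (chi w) - v) = 0,
      moment 2%N = 1 - v ^+ 2, moment 3%N = - 2 * v + 2 * v ^+ 3 &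
      moment 4%N = 1 + 2 * v ^+ 2 - 3 * v ^+ 4].
Proof.
move=> S0 hv p moment.
have Sn : #|S|%:R != 0 :> R by rewrite pnatr_eq0 -lt0n.
have p1 : \sum_w p w = 1.
  rewrite -mulr_suml -natr_sum -[X in X%:R * _]big_mkcond /= sum1_card.
  exact: divff.
have pv : \sum_w p w * pm (chi w) = v.
  rewrite -[RHS](mulKf Sn) -hv mulrC mulr_suml [RHS]big_mkcond/=.
  by apply: eq_bigr => w _; rewrite /p; case: ifP; rewrite ?mul0r// mul1r mulrC.
have E (a b : R) F : (forall w, F w = a + b * pm (chi w)) ->
    \sum_w p w * F w = a + b * v.
  move=> h; transitivity (a * (\sum_w p w) + b * \sum_w p w * pm (chi w)).
    by rewrite !mulr_sumr -big_split; apply: eq_bigr => w _ /=; rewrite h; ring.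
  by rewrite p1 pv mulr1.
split=> //.
- by rewrite (E (- v) 1)//; [ring | move=> w; ring].
- rewrite /moment (E (1 + v ^+ 2) (- 2 * v)); first by ring.
  by move=> w; rewrite /pm; case: chi; ring.
- rewrite /moment (E (- 3 * v - v ^+ 3) (1 + 3 * v ^+ 2)); first by ring.
  by move=> w; rewrite /pm; case: chi; ring.
- rewrite /moment (E (1 + 6 * v ^+ 2 + v ^+ 4) (- 4 * v - 4 * v ^+ 3)); first by ring.
  by move=> w; rewrite /pm; case: chi; ring.
Qed.

(* Second-moment method for [U = (Z + s) ^ 2]:
   [1{U > T} >= 2 l (U - T) - l ^ 2 (U - T) ^ 2], with [l = 1 / (3 E U)] since
   [E U ^ 2] is at most about [3 (E U) ^ 2]. *)
Lemma paley_zygmund_bound (n V Q s T M3 M4 l : R) :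
  1 <= n -> V = n - Q -> Q <= n / 128 -> 0 <= Q -> 0 <= T -> T <= n / 64 ->
  M4 <= 3 * V ^+ 2 -> 4 * s * M3 <= n * s ^+ 2 / 2 + 32 * Q ->
  l = 1 / (3 * (V + s ^+ 2)) ->
  4 / 15 <= 2 * l * (V + s ^+ 2 - T) - l ^+ 2 *
    (M4 + 4 * s * M3 + 6 * s ^+ 2 * V + s ^+ 4 - 2 * T * (V + s ^+ 2) + T ^+ 2).
Proof.
move=> n1 VE Qn Q0 T0 Tn hM4 hM3 lE.
pose a := V + s ^+ 2; rewrite -/a in lE *.
have s0 := sqr_ge0 s.
have V1 : n <= 11 / 10 * V by clear -VE Qn n1; lra.
have Va : V <= a by rewrite /a lerDl.
have a0 : 0 < a by clear -V1 Va n1; lra.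
have la : l * a = 1 / 3.
  by rewrite lE; field; clear -a0; rewrite gt_eqF.
have l0 : 0 < l by rewrite lE divr_gt0// mulr_gt0.
have sq : V * s ^+ 2 <= a ^+ 2 / 4.
  have := sqr_ge0 (V - s ^+ 2); rewrite /a; clear.
  have -> : (V + s ^+ 2) ^+ 2 = (V - s ^+ 2) ^+ 2 + 4 * (V * s ^+ 2) by ring.
  by lra.
have ns : n * s ^+ 2 <= 11 / 40 * a ^+ 2.
  have := ler_wpM2r s0 V1; rewrite -mulrA; clear -sq; lra.
have nn : n <= 121 / 100 * a ^+ 2.
  have na : n <= 11 / 10 * a by clear -V1 Va; lra.
  have : 1 <= 11 / 10 * a by clear -na n1; lra.
  have a0' : 0 <= 11 / 10 * a by clear -a0; lra.
  move=> /(ler_wpM2l a0'); rewrite mulr1; clear -na.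
  have -> : 11 / 10 * a * (11 / 10 * a) = 121 / 100 * a ^+ 2 by field.
  by lra.
(* [3 a ^ 2] covers [3 V ^ 2 + 6 s ^ 2 V + s ^ 4]; the remaining [n s ^ 2 / 2 + 32 Q] costs at most
   [11/80 + 121/400 = 11/25] of [a ^ 2]. *)
have W : M4 + 4 * s * M3 + 6 * s ^+ 2 * V + s ^+ 4 <= 86 / 25 * a ^+ 2.
  have aE : a ^+ 2 = V ^+ 2 + 2 * (s ^+ 2 * V) + s ^+ 4 by rewrite /a; ring.
  have s4 : 0 <= s ^+ 4 by rewrite (_ : s ^+ 4 = (s ^+ 2) ^+ 2) ?sqr_ge0//; ring.
  have : 0 <= V ^+ 2 by exact: sqr_ge0.
  rewrite -(mulrA 6); clear - aE s4 nn ns hM3 hM4 Qn; lra.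
have lW := ler_wpM2l (sqr_ge0 l) W.
have lT0 : 0 <= l * T by rewrite mulr_ge0// ltW.
have lT : l * T <= 1 / 174.
  have : T <= a / 58 by clear -Tn V1 Va a0; lra.
  by move=> /(ler_wpM2l (ltW l0)); rewrite mulrA la; clear; lra.
have e1 : l ^+ 2 * (86 / 25 * a ^+ 2) = 86 / 225.
  have -> : l ^+ 2 * (86 / 25 * a ^+ 2) = 86 / 25 * (l * a) ^+ 2 by ring.
  by rewrite la; field.
rewrite e1 in lW.
have -> : 2 * l * (a - T) = 2 * (l * a) - 2 * (l * T) by ring.
rewrite [X in _ - X](_ : _ = l ^+ 2 * (M4 + 4 * s * M3 + 6 * s ^+ 2 * V + s ^+ 4)
  - 2 * (l * T) * (l * a) + (l * T) * (l * T)); last by ring.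
have sm : (l * T) * (l * T) <= 1 / 174 * (l * T) by rewrite ler_wpM2r.
(* The main terms leave [2/3 - 86/225 = 64/225], which exceeds [4/15] by [4/225]; this absorbs the
   terms in [l * T <= 1/174]. *)
rewrite la; clear -lW lT lT0 sm; lra.
Qed.

(** Under the uniform law on the box the signs are independent, and the guess [g] only shifts their
    centred sum by [s]. Small total squared bias keeps the variance close to [n]. *)
Lemma sum_pm_anticoncentration n (S : 'I_n -> {set A}) (v : 'I_n -> R) (g T : R) :
  (0 < n)%N ->
  (forall i, \sum_(w in S i) pm (chi w) = #|S i|%:R * v i) ->
  \sum_i v i ^+ 2 <= n%:R / 128 -> 0 <= T -> T <= n%:R / 64 ->
  4 / 15 * #|box S|%:R <=
  #|[set f in box S | T < (\sum_i pm (chi (f i)) - g) ^+ 2]%SET|%:R :> R.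
Proof.
move=> n0 hv hQ T0 hT.
have [Sgt0|/existsNP[i /negP]] := pselect (forall i, (0 < #|S i|)%N); last first.
  rewrite -eqn0Ngt => Si0; rewrite card_box (bigD1 i)//= (eqP Si0).
  by rewrite mul0r mulr0 ler0n.
pose p i w : R := (w \in S i)%:R / #|S i|%:R.
pose Z i w : R := pm (chi w) - v i.
have mom i := pm_moments (Sgt0 i) (hv i).
have h0 i : \sum_w p i w = 1 by case: (mom i).
have h1 i : \sum_w p i w * Z i w = 0 by case: (mom i).
have h2 i : \sum_w p i w * Z i w ^+ 2 = 1 - v i ^+ 2 by case: (mom i).
have h3 i : \sum_w p i w * Z i w ^+ 3 = - 2 * v i + 2 * v i ^+ 3 by case: (mom i).
have h4 i : \sum_w p i w * Z i w ^+ 4 = 1 + 2 * v i ^+ 2 - 3 * v i ^+ 4.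
  by case: (mom i).
have := sum_moments h0 h1 h2 h3 h4.
rewrite /=; set M := mean _ => -[m0 m1 m2 m3 m4].
have v1 i : v i ^+ 2 <= 1.
  rewrite -subr_ge0 -h2 sumr_ge0// => w _.
  by rewrite mulr_ge0 ?sqr_ge0// divr_ge0.
set Q := \sum_i v i ^+ 2 in hQ.
have Q0 : 0 <= Q by apply: sumr_ge0 => i _; exact: sqr_ge0.
have VE : \sum_i (1 - v i ^+ 2) = n%:R - Q.
  by rewrite sumrB sumr_const card_ord.
pose s := \sum_i v i - g.
set V := \sum_i (1 - _) in m2 m4 VE.
set M3 := \sum_i _ in m3.
have hM3 : 4 * s * M3 <= n%:R * s ^+ 2 / 2 + 32 * Q.
  rewrite /M3 mulr_sumr /Q mulr_sumr.
  have -> : n%:R * s ^+ 2 / 2 = \sum_(i < n) s ^+ 2 / 2.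
    by rewrite sumr_const card_ord -[RHS]mulr_natl mulrA.
  rewrite -big_split ler_sum// => i _ /=.
  (* Completing the square bounds the skewness term [- 8 s v (1 - v ^ 2)] by
     [s ^ 2 / 2 + 32 v ^ 2 (1 - v ^ 2) ^ 2]. *)
  have e0 := sqr_ge0 (s + 8 * (v i * (1 - v i ^+ 2))).
  have e1 : (v i * (1 - v i ^+ 2)) ^+ 2 <= v i ^+ 2.
    rewrite exprMn ler_piMr ?sqr_ge0// expr_le1//; first by have := sqr_ge0 (v i); lra.
    by rewrite subr_ge0.
  clear -e0 e1; nra.
(* Each fourth cumulant is at most [- 2 + 8 v ^ 2], and [8 Q <= n / 16]. *)
have hM4 : 3 * V ^+ 2 +
    \sum_i (1 + 2 * v i ^+ 2 - 3 * v i ^+ 4 - 3 * (1 - v i ^+ 2) ^+ 2) <= 3 * V ^+ 2.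
  rewrite -lerBrDl subrr; apply: (@le_trans _ _ (\sum_i (- 2 + 8 * v i ^+ 2))).
    apply: ler_sum => i _; have := sqr_ge0 (v i ^+ 2).
    by rewrite (_ : v i ^+ 4 = (v i ^+ 2) ^+ 2); [nra | ring].
  rewrite big_split/= sumr_const card_ord -mulr_sumr -/Q -[- 2 *+ n]mulr_natl.
  have : 0 <= n%:R :> R by []. lra.
have n1 : 1 <= n%:R :> R by rewrite ler1n.
have := paley_zygmund_bound n1 VE hQ Q0 T0 hT hM4 hM3 erefl.
set l := 1 / _.
set M4 := _ + \sum_i _ in m4 hM4 *.
have P0 : 0 <= #|box S|%:R :> R by [].
have ME F : #|box S|%:R * M F = \sum_(f in box S) F f.
  rewrite card_box /M /mean mulr_sumr [RHS]big_mkcond/=; apply: eq_bigr => f _.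
  rewrite mulrA -big_split/= (eq_bigr (fun i => (f i \in S i)%:R)); last first.
    by move=> i _; rewrite /p mulrC divfK// pnatr_eq0 -lt0n.
  by rewrite prod_indic inE; case: ifP; rewrite ?mul0r ?mul1r.
move=> /(ler_wpM2l P0); rewrite mulrC => /le_trans; apply.
rewrite -m4 -m3 -m2.
(* The minorant of the indicator has degree 4 in [z], so the five moments determine its mean. *)
pose q z := 2 * l * ((z + s) ^+ 2 - T) - l ^+ 2 * ((z + s) ^+ 2 - T) ^+ 2.
have Mq : M (fun f => q (\sum_i Z i (f i))) =
    2 * l * (V + s ^+ 2 - T) - l ^+ 2 * (M4 + 4 * s * M3 + 6 * s ^+ 2 * V +
      s ^+ 4 - 2 * T * (V + s ^+ 2) + T ^+ 2).
  transitivity (let P k := M (fun f : {ffun 'I_n -> A} => (\sum_i Z i (f i)) ^+ k) in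
    (2 * l * (s ^+ 2 - T) - l ^+ 2 * (s ^+ 2 - T) ^+ 2) * P 0%N +
    (4 * l * s - 4 * l ^+ 2 * s * (s ^+ 2 - T)) * P 1%N +
    (2 * l - l ^+ 2 * (2 * (s ^+ 2 - T) + 4 * s ^+ 2)) * P 2%N +
    (- 4 * l ^+ 2 * s) * P 3%N + (- l ^+ 2) * P 4%N).
    rewrite /M /mean /= !mulr_sumr -!big_split/=; apply: eq_bigr => f _.
    by rewrite /q; ring.
  by rewrite /= m0 m1 m2 m3 m4; ring.
rewrite m2 m3 m4 -Mq ME.
rewrite -sum1_card natr_sum big_mkcond [leRHS]big_mkcond/=; apply: ler_sum => f _.
rewrite !inE; case: ifP => //= _.
have -> : q (\sum_i Z i (f i)) = (let y := l * ((\sum_i pm (chi (f i)) - g) ^+ 2 - T)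
    in 2 * y - y ^+ 2).
  by rewrite /q /s /Z sumrB /=; ring.
rewrite /=; set y := l * _.
(* [2 y - y ^ 2] is at most 1 everywhere and at most 0 for [y <= 0]. *)
case: ltP => hU; first by have := sqr_ge0 (y - 1); nra.
have : y <= 0.
  rewrite /y mulr_ge0_le0 ?subr_le0// /l divr_ge0// mulr_ge0// addr_ge0 ?sqr_ge0//.
  by rewrite VE; clear -hQ n1; lra.
by have := sqr_ge0 y; clear; lra.
Qed.

End Anticoncentration.

(** * Lower bound for transcripts of bounded size *)

Lemma natr_exp2_le_expR (R : realType) k : (2 ^ k)%N%:R <= expR k%:R :> R.
Proof.
rewrite natrX -[k%:R]mulr1 expRM_natl lerXn2r ?nnegrE ?expR_ge0//.
by have := expR_ge1Dx (1 : R).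
Qed.

Section TranscriptBound.
Variables (R : realType) (D n ell : nat).
Let cube := {ffun 'I_D -> bool}.

(** Otherwise the squared biases total at least [n D / 128]. The level-1 inequality, multiplied over
    the rounds, then gives the box density at most [expR (- n D / 1024)], hence at most
    [2 ^ (- (ell n + 4))], against the density hypothesis. *)
Lemma unbiased_coordinate (S : 'I_n -> {set cube}) : (0 < D)%N ->
  8 * (ell * n + 4)%:R <= (n * D)%:R / 128 :> R ->
  #|{ffun 'I_n -> cube}|%:R < (16 * 2 ^ (ell * n))%:R * #|box S|%:R :> R ->
  exists x, exists v : 'I_n -> R,
    (forall i, \sum_(w in S i) pm (w x) = #|S i|%:R * v i) /\
    \sum_i v i ^+ 2 <= n%:R / 128.
Proof.
move=> D0 hD hbox.
pose v x i : R := (\sum_(w in S i) pm (w x)) / #|S i|%:R.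
have hv i x : \sum_(w in S i) pm (w x) = #|S i|%:R * v x i.
  have [S0|S0] := eqVneq #|S i| 0%N.
    by rewrite big1 ?S0 ?mul0r// => w; rewrite (cards0_eq S0) inE.
  by rewrite mulrC divfK// pnatr_eq0.
suff : exists x, \sum_i v x i ^+ 2 <= n%:R / 128.
  by move=> [x hx]; exists x, (v x); split.
apply/not_existsP => big.
have lo : (n * D)%:R / 128 <= \sum_i \sum_x v x i ^+ 2.
  rewrite exchange_big/= natrM mulrAC mulr_natr -[X in _ *+ X]card_ord -sumr_const.
  by apply: ler_sum => x _; apply/ltW; rewrite ltNge; apply/negP/big.
have hi : #|box S|%:R * expR ((\sum_i \sum_x v x i ^+ 2) / 8) <=
    #|{ffun 'I_n -> cube}|%:R.
  rewrite card_box mulr_suml expR_sum -big_split/= card_ffun card_ord natrX.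
  rewrite -[X in _ ^+ X]card_ord -prodr_const ler_prod// => i _.
  by rewrite mulr_ge0 ?expR_ge0//= level1_inequality.
have := le_lt_trans hi hbox; rewrite mulrC ltr_pM2r; last first.
  have [b0|] := posnP #|box S|; last by rewrite ltr0n.
  by move: hbox; rewrite b0 mulr0 ltNge ler0n.
apply/negP; rewrite -leNgt.
have -> : (16 * 2 ^ (ell * n) = 2 ^ (ell * n + 4))%N by rewrite expnD mulnC.
apply: le_trans (natr_exp2_le_expR _ _) _.
rewrite ler_expR; lra.
Qed.

(* Given a transcript the inputs of the rounds are independent. Transcripts
   whose box of inputs has density at most [2 ^ (- ell n) / 16] carry at most
   [1 / 16] of the mass; for all others some coordinate is nearly unbiased. *)
Lemma transcript_lower_bound (Yt : finType) (y : {ffun 'I_n -> cube} -> Yt)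
    (S : Yt -> 'I_n -> {set cube}) (g : Yt -> 'I_D -> R) (T : R) :
  (0 < D)%N -> (0 < n)%N ->
  (forall b t, (b \in box (S t)) = (y b == t)) ->
  (#|Yt| <= 2 ^ (ell * n))%N ->
  8 * (ell * n + 4)%:R <= (n * D)%:R / 128 :> R ->
  0 <= T -> T <= n%:R / 64 ->
  1 / 4 * #|{ffun 'I_n -> cube}|%:R <=
  #|[set b : {ffun 'I_n -> cube} |
       [exists x, T < (\sum_i pm (b i x) - g (y b) x) ^+ 2]]%SET|%:R :> R.
Proof.
move=> D0 n0 yS hY hD T0 hT.
set N := #|{ffun 'I_n -> cube}|%:R; set F := finset _.
pose q : R := N / (16 * 2 ^ (ell * n))%:R.
have q0 : 0 <= q by rewrite divr_ge0.
have c0 : 0 < (16 * 2 ^ (ell * n))%:R :> R by rewrite ltr0n muln_gt0 expn_gt0.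
(* Subtracting [q] lets one inequality serve all transcripts: on sparse boxes its left side is
   nonpositive. *)
have one t : 4 / 15 * (#|box (S t)|%:R - q) <= #|[set b in F | y b == t]%SET|%:R.
  have [small|large] := leP #|box (S t)|%:R q.
    by apply: le_trans (ler0n _ _); rewrite mulr_ge0_le0// subr_le0.
  have hbox : N < (16 * 2 ^ (ell * n))%:R * #|box (S t)|%:R.
    by rewrite mulrC -ltr_pdivrMr.
  have [x [v [hv hQ]]] := unbiased_coordinate D0 hD hbox.
  apply: (@le_trans _ _ (4 / 15 * #|box (S t)|%:R)).
    by rewrite ler_pM2l// gerBl.
  apply: le_trans (sum_pm_anticoncentration (g t x) n0 hv hQ T0 hT) _.
  rewrite ler_nat; apply/subset_leq_card/fintype.subsetP => b; rewrite inE yS !inE.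
  by move=> /andP[/eqP -> h]; rewrite eqxx andbT; apply/existsP; exists x.
have total : \sum_t #|box (S t)|%:R = N.
  rewrite /N -sum1_card natr_sum (partition_big y xpredT)//=.
  apply: eq_bigr => t _; rewrite -sum1_card natr_sum; apply: eq_bigl => b.
  by rewrite yS.
have totalF : \sum_t #|[set b in F | y b == t]%SET|%:R = #|F|%:R :> R.
  rewrite -[#|F|]sum1_card natr_sum (partition_big y xpredT)//=.
  apply: eq_bigr => t _; rewrite -sum1_card natr_sum; apply: eq_bigl => b.
  by rewrite !inE.
have slack : \sum_(t : Yt) q <= N / 16.
  rewrite sumr_const -[_ *+ _]mulr_natr /q -mulrA ler_wpM2l//.
  rewrite mulrC ler_pdivrMr// natrM mulKf// ler_nat//.
rewrite -totalF; apply: le_trans (ler_sum _ (fun t _ => one t)).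
(* The constants meet exactly: [4/15 * (1 - 1/16) = 1/4]. *)
rewrite -mulr_sumr sumrB total; lra.
Qed.

End TranscriptBound.

(** * Sharing a histogram among the users of a round *)

Section SplitHistogram.
Variables (I X : finType).
Implicit Type H : histogram X.

Lemma sub_histogram H k : (k <= l1norm H)%N ->
  exists G : histogram X, (forall x, (G x <= H x)%N) /\ l1norm G = k.
Proof.
elim: k => [_|k IH lt_k].
  exists [ffun=> 0%N]; split=> [x|]; rewrite ?ffunE//.
  by rewrite /l1norm big1// => x _; rewrite ffunE.
have [G [leG normG]] := IH (ltnW lt_k).
have [x ltx] : exists x, (G x < H x)%N.
  apply/existsP; apply: contraTT lt_k => /existsPn h.
  by rewrite -leqNgt -normG leq_sum// => x _; rewrite leqNgt h.
exists [ffun z => (G z + (z == x))%N]; split=> [z|].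
  by rewrite ffunE; case: eqP => [->|_]; rewrite ?addn1 ?addn0.
rewrite /l1norm; under eq_bigr do rewrite ffunE.
rewrite big_split/= -/(l1norm G) normG (bigD1 x)//= eqxx big1 ?addn1// => z.
by move=> /negbTE ->.
Qed.

(** Greedy: one user takes [minn m (l1norm H)] units, and the others share the rest. *)
Lemma split_histogram (B : {set I}) m H : (l1norm H <= m * #|B|)%N ->
  exists h : I -> histogram X, (forall i, i \in B -> (l1norm (h i) <= m)%N) /\
    forall x, (\sum_(i in B) h i x)%N = H x.
Proof.
have [k] := ubnP #|B|; elim: k B H => // k IH B H ltk hH.
have [B0|[i0 iB]] := set_0Vmem B.
  exists (fun=> H); split=> [i|x]; rewrite B0 ?inE// big_set0.
  move: hH; rewrite B0 cards0 muln0 leqn0 sum_nat_eq0 => /forallP/(_ x)/eqP.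
  by [].
have [G [leG normG]] := sub_histogram (geq_minr m (l1norm H)).
have cB : #|B| = #|B :\ i0|.+1 by rewrite (cardsD1 i0) iB.
have hH' : (l1norm [ffun x => H x - G x] <= m * #|B :\ i0|)%N.
  have -> : l1norm [ffun x => (H x - G x)%N] = (l1norm H - l1norm G)%N.
    by rewrite /l1norm; under eq_bigr do rewrite ffunE; rewrite sumnB.
  by move: hH; rewrite normG cB mulnS; lia.
have [|h [hm hs]] := IH (B :\ i0) _ _ hH'; first by rewrite cB in ltk.
exists (fun i => if i == i0 then G else h i); split=> [i iB'|x].
  case: ifPn => [_|ne]; first by rewrite normG geq_minl.
  by apply: hm; rewrite !inE ne.
rewrite (big_setD1 i0)//= eqxx.
rewrite (eq_bigr (fun i => h i x)) => [|i]; last by rewrite !inE => /andP[/negbTE ->].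
by rewrite hs ffunE subnKC.
Qed.

End SplitHistogram.

(** * Averaging over datasets *)

(** The probabilities sum to the expected number of bad indices, which is at least [#|J| / 4], so
    they cannot all be at most [1 / 5]. *)
Lemma exists_gt_of_density (R : realType) (d : measure_display)
    (T : measurableType d) (P : probability T R) (J : finType) (E : J -> set T) :
  (0 < #|J|)%N -> (forall j, measurable (E j)) ->
  (forall u, 1 / 4 * #|J|%:R <= #|[set j | `[< E j u >]]%SET|%:R :> R) ->
  exists j, ((1 / 5)%:E < P (E j))%E.
Proof.
move=> J0 mE dense; apply/not_existsP => small.
have : (\sum_j P (E j) <= (1 / 5 * #|J|%:R)%:E)%E.
  have -> : (1 / 5 * #|J|%:R)%:E = (\sum_(j : J) (1 / 5 : R)%:E)%E.
    by rewrite sumEFin sumr_const mulr_natr.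
  by apply: lee_sum => j _; rewrite leNgt; apply/negP/small.
apply/negP; rewrite -ltNge; apply: (@lt_le_trans _ _ (1 / 4 * #|J|%:R)%:E).
  by rewrite lte_fin ltr_pM2r ?ltr0n//; lra.
have -> : (\sum_j P (E j) = \int[P]_u \sum_j (\1_(E j) u)%:E)%E.
  rewrite ge0_integral_sum//=.
  - by apply: eq_bigr => j _; rewrite integral_indic// setIT.
  - by move=> j; apply/measurable_EFinP/measurable_indic.
have -> : (1 / 4 * #|J|%:R)%:E = (\int[P]_u (cst (1 / 4 * #|J|%:R : R)%:E u))%E.
  by rewrite integral_cst// [X in (_ * X)%E]probability_setT mule1.
apply: ge0_le_integral => //=.
- by apply: emeasurable_sum => j; apply/measurable_EFinP/measurable_indic.
move=> u _; rewrite sumEFin lee_fin; apply: le_trans (dense u) _.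
rewrite -sum1_card natr_sum big_mkcond/= ler_sum// => j _.
by rewrite inE indicE; case: asboolP => h; rewrite ?(mem_set h) ?(memNset h).
Qed.

(** * Measurability of the error event *)

Section FiniteValued.
Variables (d : measure_display) (T : measurableType d).

(** Stated through fibres, so that rings and transcripts need no sigma-algebra. *)
Definition fin_measurable (A : Type) (f : T -> A) :=
  forall a, measurable [set u | f u = a].

Lemma fin_measurable_cst (A : Type) (c : A) : fin_measurable (fun=> c).
Proof.
move=> a; have [e|ne] := pselect (c = a).
  by rewrite (_ : [set u | _] = setT)//; apply/seteqP; split.
by rewrite (_ : [set u | _] = set0)//; apply/seteqP; split.
Qed.

(** Handles adaptive encoders: the sample space splits into finitely many pieces, one per value of
    [f]. *)
Lemma fin_measurable_dep (A : finType) (A' : Type) (f : T -> A)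
    (F : A -> T -> A') : fin_measurable f -> (forall a, fin_measurable (F a)) ->
  fin_measurable (fun u => F (f u) u).
Proof.
move=> mf mF a'.
rewrite (_ : [set u | _] = \bigcup_a ([set u | f u = a] `&` [set u | F a u = a'])).
  by apply: fin_bigcup_measurable => // a _; apply: measurableI; [exact: mf|exact: mF].
by apply/seteqP; split=> [u <-|u [a _ [<- <-]]]//=; exists (f u).
Qed.

Lemma fin_measurable_comp (A : finType) (A' : Type) (f : T -> A) (phi : A -> A') :
  fin_measurable f -> fin_measurable (fun u => phi (f u)).
Proof.
move=> mf; apply: (fin_measurable_dep (F := fun a _ => phi a) mf) => a.
exact: fin_measurable_cst.
Qed.

Lemma fin_measurable_ffun (A : finType) (B : A -> Type) (f : forall a, T -> B a) :
  (forall a, fin_measurable (f a)) ->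
  fin_measurable (fun u => [ffun a => f a u] : {ffun forall a, B a}).
Proof.
move=> mf b.
rewrite (_ : [set u | _] = \bigcap_a [set u | f a u = b a]).
  by apply: fin_bigcap_measurable => // a _; exact: mf.
apply/seteqP; split=> [u <- a _|u h] /=; first by rewrite ffunE.
by apply/ffunP => a; rewrite ffunE; exact: h.
Qed.

End FiniteValued.

Section ErrorMeasurable.
Variables (R : realType) (rounds : nat) (I X : finType).
Variables (B : 'I_rounds -> {set I}) (pi : protocol R rounds I X).
Variable h : dataset I X.

Lemma fin_measurable_observed k :
  fin_measurable (fun u : sample pi => observed B h u k).
Proof.
elim: k => [|k IH].
  exact: fin_measurable_cst.
apply: (fin_measurable_dep (F := fun y u => [ffun s : 'I_rounds =>
  if s == k :> nat then \sum_(i in B s) enc s i y (h i) u else y s]) IH) => y.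
apply: fin_measurable_ffun => s; case: eqP => _; last first.
  exact: fin_measurable_cst.
pose phi (z : {ffun I -> ring pi s}) := \sum_(i in B s) z i.
rewrite (_ : (fun _ => _) = (fun u => phi [ffun i => enc s i y (h i) u])); last first.
  by apply/funext => u; apply: eq_bigr => i _; rewrite ffunE.
apply: (fin_measurable_comp phi); apply: fin_measurable_ffun => i g.
exact: enc_measurable.
Qed.

(** [out] is measurable for each fixed transcript, so the event is split by the finitely many
    transcripts. *)
Lemma measurable_error_event (tau : R) :
  measurable (error_event B h tau : set (sample pi)).
Proof.
pose good := \bigcup_y ([set u : sample pi | observed B h u rounds = y] `&`
  \bigcap_x [set u | `|out y u x - (total_histogram B h x)%:R| <= tau]).
suff -> : error_event B h tau = ~` good.
  apply: measurableC; apply: fin_bigcup_measurable => [|y _].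
    exact: (@finite_finset {dffun forall s, ring pi s}).
  apply: measurableI; first exact: fin_measurable_observed.
  apply: fin_bigcap_measurable => // x _.
  have mf : measurable_fun setT
      (fun u : sample pi => `|out y u x - (total_histogram B h x)%:R|).
    apply: measurableT_comp => //; apply: measurable_funB => //.
    exact: out_measurable.
  rewrite -[X in measurable X]setTI.
  exact: (measurable_fun_le measurableT mf (measurable_cst _)).
apply/seteqP; split=> u hu; apply: contra_not hu.
  by move=> [y _ [<- hu]] x; exact: hu.
by move=> hu; exists (observed B h u rounds) => //; split=> // x _; exact: hu.
Qed.

End ErrorMeasurable.

(** * Transcripts of the embedded cube *)

Lemma card_transcripts (R : realType) (rounds : nat) (I X : finType)
    (pi : protocol R rounds I X) ell : has_cost pi ell ->
  (#|{dffun forall s, ring pi s}| <= 2 ^ (ell * rounds))%N.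
Proof.
move=> hc; rewrite card_dep_ffun foldrE big_map big_enum/= expnM.
by rewrite -[rounds in leqRHS]card_ord -prod_nat_const leq_prod.
Qed.

Section Embedding.
Variables (R : realType) (rounds : nat) (I X : finType).
Variables (B : 'I_rounds -> {set I}) (pi : protocol R rounds I X).
Variables (D a : nat) (e : 'I_D -> X).
Hypothesis e_inj : injective e.
Hypothesis disj_B : forall r s, r != s -> [disjoint B r & B s]%B.
Let cube := {ffun 'I_D -> bool}.

Definition scaled_hist (w : cube) : histogram X :=
  [ffun x => \sum_(j | e j == x) a * w j]%N.

Lemma l1norm_scaled_hist w : (l1norm (scaled_hist w) <= a * D)%N.
Proof.
rewrite /l1norm; under eq_bigr do rewrite ffunE.
have -> : (\sum_x \sum_(j | e j == x) a * w j = \sum_j a * w j)%N.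
  by rewrite [RHS](partition_big e xpredT).
rewrite -[D in leqRHS]card_ord mulnC.
rewrite -sum_nat_const leq_sum// => j _.
by case: (w j); rewrite ?muln1 ?muln0.
Qed.

Lemma scaled_histE w j : scaled_hist w (e j) = (a * w j)%N.
Proof.
rewrite ffunE (big_pred1 j) // => j'.
by rewrite (inj_eq e_inj).
Qed.

Variable share : 'I_rounds * cube -> I -> histogram X.
Hypothesis shareE : forall p x,
  (\sum_(i in B p.1) share p i x)%N = scaled_hist p.2 x.

(** [pick] recovers the round of a user, unique by disjointness; users of no round get the zero
    histogram. *)
Definition cube_data (b : {ffun 'I_rounds -> cube}) : dataset I X :=
  fun i => if [pick r | i \in B r] is Some r then share (r, b r) i else [ffun=> 0%N].

Lemma cube_dataE b r i : i \in B r -> cube_data b i = share (r, b r) i.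
Proof.
move=> ir; rewrite /cube_data; case: pickP => [r' ir'|/(_ r)]; last by rewrite ir.
have [->//|ne] := eqVneq r' r.
by have := disjointFr (disj_B ne) ir'; rewrite ir.
Qed.

Lemma total_cube_data b j :
  total_histogram B (cube_data b) (e j) = (a * \sum_r b r j)%N.
Proof.
rewrite /total_histogram big_distrr/=; apply: eq_bigr => r _.
rewrite -scaled_histE -(shareE (r, b r)).
by apply: eq_bigr => i ir; rewrite (cube_dataE _ ir).
Qed.

Variable u : sample pi.
Let transcript := {dffun forall s, ring pi s}.
Let trunc k (y : transcript) : transcript :=
  [ffun s : 'I_rounds => if (s < k)%N then y s else 0].

(** The encoders of round [r] see [trunc r y], which is fixed once [y] is. Hence the condition
    involves the input of round [r] alone, even in an interactive protocol. *)
Definition consistent (y : transcript) (r : 'I_rounds) : {set cube} :=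
  [set w | \sum_(i in B r) enc r i (trunc r y) (share (r, w) i) u == y r]%SET.

(** This is the independence of the rounds given the transcript. One direction rebuilds [y] round by
    round; the other uses that an entry is zero before its round and constant after it. *)
Lemma consistentP b (y : transcript) :
  (b \in box (consistent y)) = (observed B (cube_data b) u rounds == y).
Proof.
have sumE (r : 'I_rounds) z : \sum_(i in B r) enc r i z (cube_data b i) u =
    \sum_(i in B r) enc r i z (share (r, b r) i) u.
  by apply: eq_bigr => i ir; rewrite (cube_dataE _ ir).
have truncK (z : transcript) : trunc rounds z = z.
  by apply/ffunP => s; rewrite ffunE ltn_ord.
rewrite inE; apply/forallP/eqP => [h|<- r].
  suff H k : observed B (cube_data b) u k = trunc k y by rewrite H truncK.
  elim: k => [|k IH]; apply/ffunP => s; rewrite /= !ffunE// IH ltnS leq_eqVlt.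
  case: eqP => /= [sk|_]; last by rewrite ffunE.
  by rewrite -sk sumE; have := h s; rewrite inE => /eqP.
have obs k k' (s : 'I_rounds) : (s < k)%N -> (k <= k')%N ->
    observed B (cube_data b) u k' s = observed B (cube_data b) u k s.
  move=> sk /subnK <-; elim: (k' - k)%N => //= d IH.
  by rewrite ffunE ifN ?IH// neq_ltn ltn_addl.
have obs0 k (s : 'I_rounds) : (k <= s)%N -> observed B (cube_data b) u k s = 0.
  elim: k => [_|k IH sk]; first by rewrite ffunE.
  by rewrite /= ffunE ifN ?IH ?(ltnW sk)// neq_ltn sk orbT.
rewrite inE; apply/eqP; rewrite (obs r.+1)//= ffunE eqxx sumE.
apply: eq_bigr => i _; congr (enc _ _ _); apply/ffunP => s; rewrite ffunE.
by case: ltnP => sr; [rewrite (obs r)// ltnW | rewrite obs0].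
Qed.

End Embedding.

(** * Lower bounds for one protocol *)

Section SingleProtocol.
Variables (R : realType) (rounds : nat) (I X : finType).
Variables (B : 'I_rounds -> {set I}) (pi : protocol R rounds I X).
Variables (m n ell : nat) (tau : R).
Hypothesis card_B : forall r, #|B r| = n.
Hypothesis disj_B : forall r s, r != s -> [disjoint B r & B s]%B.
Hypothesis cost_pi : has_cost pi ell.
Hypothesis tau_gt0 : 0 < tau.

Lemma cube_lower_bound D a : (0 < D)%N -> (0 < a)%N -> (0 < rounds)%N ->
  (D <= #|X|)%N -> (a * D <= m * n)%N ->
  (8 * 128 * (ell * rounds + 4) <= rounds * D)%N ->
  16 * tau <= a%:R * Num.sqrt rounds%:R ->
  exists h : dataset I X,
    (forall r i, i \in B r -> (l1norm (h i) <= m)%N) /\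
    ((1 / 5)%:E < error_prob B pi h tau)%E.
Proof.
move=> D0 a0 n0 DX aD hell htau.
pose cube := {ffun 'I_D -> bool}.
pose e (j : 'I_D) : X := enum_val (widen_ord DX j).
have e_inj : injective e.
  by move=> j j' /enum_val_inj/(congr1 val)/= /val_inj.
have /choice[share shareP] (p : 'I_rounds * cube) : exists s : I -> histogram X,
    (forall i, i \in B p.1 -> (l1norm (s i) <= m)%N) /\
    forall x, (\sum_(i in B p.1) s i x)%N = scaled_hist a e p.2 x.
  apply: split_histogram; rewrite card_B.
  exact: leq_trans (l1norm_scaled_hist _ _ _) aD.
have shareE p := (shareP p).2.
pose data := cube_data B share.
suff [b hb] : exists b, ((1 / 5)%:E < shared pi (error_event B (data b) tau))%E.
  exists (data b); split=> // r i ir.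
  by rewrite /data (cube_dataE disj_B _ _ ir); exact: (shareP (r, b r)).1.
apply: exists_gt_of_density => [|b|u].
- by rewrite card_ffun expn_gt0 card_ffun expn_gt0 card_bool.
- exact: measurable_error_event.
have aR : 0 < a%:R :> R by rewrite ltr0n.
(* As [pm b = 2 b - 1], an error of [tau] on the scaled count is an error of [2 tau / a] on the sum
   of signs. *)
pose T := (2 * tau / a%:R) ^+ 2.
have hT : T <= rounds%:R / 64.
  rewrite /T -[rounds%:R]sqr_sqrtr// (_ : _ / 64 = (Num.sqrt rounds%:R / 8) ^+ 2);
    last by field.
  rewrite ler_pXn2r ?nnegrE ?divr_ge0 ?mulr_ge0 ?sqrtr_ge0 ?(ltW tau_gt0)//.
  by rewrite ler_pdivrMr//; lra.
have hD : 8 * (ell * rounds + 4)%:R <= (rounds * D)%:R / 128 :> R.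
  by rewrite ler_pdivlMr// mulrAC -!natrM ler_nat.
(* The guess for the sum of signs is the estimate rescaled by [2 / a] and shifted by [rounds]. *)
apply: le_trans (transcript_lower_bound
  (y := fun b => observed B (data b) u rounds) (S := consistent B share u)
  (fun y j => 2 * out y u (e j) / a%:R - rounds%:R) D0 n0
  (consistentP disj_B share u) (card_transcripts cost_pi) hD (sqr_ge0 _) hT) _.
rewrite ler_nat; apply/subset_leq_card/fintype.subsetP => b.
rewrite !inE => /existsP[j]; set g := 2 * _ / _ - _; move=> far ok.
have := ok (e j); rewrite /estimate (total_cube_data e_inj disj_B shareE).
set o := out _ _ _ => okj.
move: far; apply/negP; rewrite -leNgt /T.
have -> : \sum_r pm (b r j) - g = 2 / a%:R * ((a * \sum_r b r j)%N%:R - o).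
  have -> : \sum_r pm (b r j) = 2 * (\sum_r b r j)%N%:R - rounds%:R :> R.
    have -> : rounds%:R = \sum_(r < rounds) 1 :> R by rewrite sumr_const card_ord.
    rewrite natr_sum mulr_sumr -sumrB.
    by apply: eq_bigr => r _; rewrite /pm; case: (b r j) => /=; ring.
  by rewrite /g -/o natrM; field; rewrite gt_eqF.
rewrite [2 * tau / _]mulrAC !(exprMn _ (2 / a%:R)) ler_pM2l ?exprn_gt0 ?divr_gt0//.
by rewrite -[leLHS]real_normK ?num_real// distrC ler_pXn2r ?nnegrE// ltW.
Qed.

(** Zero bits leave a single transcript, hence one output for two datasets whose counts at [x0]
    differ by [m n rounds > 2 tau]: for every [u] one of them errs. *)
Lemma zero_cost_lower_bound (x0 : X) : ell = 0%N ->
  2 * tau < (m * n * rounds)%:R ->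
  exists h : dataset I X,
    (forall r i, i \in B r -> (l1norm (h i) <= m)%N) /\
    ((1 / 5)%:E < error_prob B pi h tau)%E.
Proof.
move=> ell0 htau.
pose data (c : bool) : dataset I X := fun=>
  [ffun x => if x == x0 then (c * m)%N else 0%N].
suff [c hc] : exists c, ((1 / 5)%:E < shared pi (error_event B (data c) tau))%E.
  exists (data c); split=> // r i _.
  rewrite /l1norm (bigD1 x0)//= ffunE eqxx big1 ?addn0.
    by case: (c); rewrite ?mul1n ?mul0n.
  by move=> x /negbTE ne; rewrite ffunE ne.
apply: exists_gt_of_density => [|c|u]; first by rewrite card_bool.
  exact: measurable_error_event.
rewrite card_bool; apply: (@le_trans _ _ 1); first by lra.
rewrite ler1n card_gt0; apply/set0Pn.
suff [c hc] : exists c, error_event B (data c) tau u.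
  by exists c; rewrite !inE.
apply/not_existsP => ok.
have total c : total_histogram B (data c) x0 = (c * (m * n * rounds))%N.
  rewrite /total_histogram.
  under eq_bigr => r _.
    under eq_bigr do rewrite ffunE eqxx.
    rewrite sum_nat_const card_B; over.
  by rewrite sum_nat_const card_ord; lia.
have le1 : (#|{dffun forall s, ring pi s}| <= 1)%N.
  by have := card_transcripts cost_pi; rewrite ell0 mul0n.
have same : observed B (data true) u rounds = observed B (data false) u rounds.
  by have /fintype_le1P := le1; apply.
have /contrapT/(_ x0) := ok true; have /contrapT/(_ x0) := ok false.
rewrite /estimate same !total mul0n mul1n !ler_distl; lra.
Qed.

(** In the constant, 32 is the ratio of [cost_bound] to [D], [8 * 128] comes from the level-1
    exponent and the bias threshold, and 5 absorbs the summand 4 in [ell * rounds + 4] once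
    [ell > 0]. *)
Lemma protocol_lower_bound :
  2 * tau < (m * n * rounds)%:R ->
  cost_bound m n rounds tau <= #|X|%:R ->
  (32 * (8 * 128 * 5))%N%:R * ell%:R <= cost_bound m n rounds tau ->
  exists h : dataset I X,
    (forall r i, i \in B r -> (l1norm (h i) <= m)%N) /\
    ((1 / 5)%:E < error_prob B pi h tau)%E.
Proof.
move=> htau hX hell; set K := cost_bound _ _ _ _ in hX hell.
have : (0 < m * n * rounds)%N.
  by rewrite -(ltr0n R); apply: lt_trans htau; rewrite mulr_gt0.
rewrite muln_gt0 => /andP[mn0 n0].
have mnR : 0 < (m * n)%:R :> R by rewrite ltr0n.
have sR : 0 < Num.sqrt rounds%:R :> R by rewrite sqrtr_gt0 ltr0n.
have K0 : 0 < K by rewrite /K /cost_bound lt_min divr_gt0 ?mulr_gt0.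
have [ell0|ell0] := posnP ell.
  have /card_gt0P[x0 _] : (0 < #|X|)%N by rewrite -(ltr0n R); exact: lt_le_trans hX.
  exact: (zero_cost_lower_bound x0).
have Kmn : K <= (m * n)%:R by rewrite /K /cost_bound ge_min lexx orbT.
have Ksqrt : K * tau <= (m * n)%:R * Num.sqrt rounds%:R.
  by rewrite -ler_pdivlMr// /K /cost_bound ge_min lexx.
have K32 : 0 <= K / 32 by rewrite divr_ge0// ltW.
pose D := Num.truncn (K / 32).
have DK : 32 * D%:R <= K.
  by rewrite mulrC -ler_pdivlMr// truncn_le.
have DKw : D%:R <= K by apply: le_trans DK; rewrite ler_peMl// ler1n.
have ellD : (8 * 128 * 5 * ell <= D)%N.
  rewrite truncn_ge_nat//.
  by rewrite ler_pdivlMr// mulrC -!natrM mulnA natrM.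
have D0 : (0 < D)%N by apply: leq_trans ellD; rewrite muln_gt0.
have Dmn : (D <= m * n)%N by rewrite -(ler_nat R); exact: le_trans Kmn.
apply: (cube_lower_bound (D := D) (a := (m * n) %/ D)) => //.
- by rewrite divn_gt0.
- by rewrite -(ler_nat R); exact: le_trans hX.
- exact: leq_divM.
- apply: (@leq_trans (8 * 128 * 5 * (ell * rounds))%N).
    have : (0 < ell * rounds)%N by rewrite muln_gt0 ell0.
    move: (ell * rounds)%N => k k0; rewrite -(mulnA _ 5) leq_mul2l/= mulSn.
    by rewrite leq_add2l -[X in (X <= _)%N]muln1 leq_mul2l.
  by rewrite (mulnA (8 * 128 * 5)%N) (mulnC rounds) leq_mul2r ellD orbT.
set a := (_ %/ _)%N.
have a0 : (0 < a)%N by rewrite divn_gt0.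
(* Rounding down in [a] loses at most a factor 2, since [a >= 1]; this turns 32 into 16. *)
have mn2 : (m * n)%:R <= 2 * (a%:R * D%:R) :> R.
  rewrite -!natrM ler_nat {1}(divn_eq (m * n) D) -/a.
  rewrite mul2n -addnn leq_add2l (leq_trans (ltnW (ltn_pmod _ D0)))//.
  exact: leq_pmull.
have aK : 16 * (m * n)%:R <= a%:R * K.
  have := ler_wpM2l (ler0n R a) DK; lra.
(* After multiplication by [m n], both sides are compared with [a K tau]. *)
rewrite -(ler_pM2l mnR).
have := ler_wpM2r (ltW tau_gt0) aK; have := ler_wpM2l (ler0n R a) Ksqrt.
rewrite !mulrA; lra.
Qed.

End SingleProtocol.

(** The asymptotics run along an arbitrary filter on instances. [tau_nontrivial] excludes the case
    in which the constant answer [m n rounds / 2] is always within [tau]; [domain_large] makes room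
    for the [D] coordinates. *)
Theorem theorem4 (R : realType) (T : Type) (F : filter_on T)
    (m n rounds ell : T -> nat) (tau : T -> R) (I X : T -> finType)
    (B : forall t, 'I_(rounds t) -> {set I t})
    (pi : forall t, protocol R (rounds t) (I t) (X t))
    (card_B : forall t r, #|B t r| = n t)
    (disj_B : forall t r s, r != s -> [disjoint B t r & B t s]%B)
    (tau_gt0 : forall t, 0 < tau t)
    (tau_nontrivial : forall t, 2 * tau t < (m t * n t * rounds t)%:R)
    (domain_large : forall t,
       cost_bound (m t) (n t) (rounds t) (tau t) <= #|X t|%:R)
    (cost_pi : forall t, has_cost (pi t) (ell t))
    (cost_small : (fun t => (ell t)%:R : R) =o_F
       (fun t => cost_bound (m t) (n t) (rounds t) (tau t))) :
  \forall t \near F, exists h : dataset (I t) (X t),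
    (forall r i, i \in B t r -> (l1norm (h i) <= m t)%N) /\
    ((1 / 5)%:E < error_prob (B t) (pi t) h (tau t))%E.
Proof.
move/eqoP: cost_small; set k : R := (32 * (8 * 128 * 5))%N%:R.
have k0 : 0 < k by rewrite ltr0n.
(* Little-o enters only through the single constant [k^-1]. *)
move=> /(_ k^-1); rewrite invr_gt0 => /(_ k0); apply: filterS => t.
have cb0 : 0 <= cost_bound (m t) (n t) (rounds t) (tau t).
  by rewrite /cost_bound le_min ler0n andbT divr_ge0 ?mulr_ge0 ?sqrtr_ge0 ?(ltW (tau_gt0 t)).
rewrite !ger0_norm// => /(ler_wpM2l (ltW k0)); rewrite mulVKf ?gt_eqF// => hell.
exact: (protocol_lower_bound (card_B t) (@disj_B t) (cost_pi t)).
Qed.
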